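(* Let $m\ge 2$ be an even integer, $n\ge1$ an integer, and let $\mathcal{A}$ be a real centrosymmetric tensor of order $m$ and dimension $n$. If $\mathcal{A}$ has a real right inverse of order $2$ and dimension $n$ (i.e. there is a real $n\times n$ matrix $B$ with $\mathcal{A}B=\mathcal{I}$), then this order $2$ real right inverse is unique and it is centrosymmetric.
   Context: Write $[n]=\{1,\dots,n\}$. A real tensor of order $m$ and dimension $n$ is an array $\mathcal{A}=(a_{i_1\cdots i_m})$ of reals with $i_1,\dots,i_m\in[n]$; an order 2 tensor is an $n\times n$ matrix. It is centrosymmetric if $a_{i_1\cdots i_m}=a_{n-i_1+1,\dots,n-i_m+1}$ for all indices. For a matrix $B=(b_{ij})$ the product $\mathcal{A}B$ is the tensor of order $m$ and dimension $n$ with entries $(\mathcal{A}B)_{i_1\cdots i_m}=\sum_{j_2,\dots,j_m\in[n]}a_{i_1j_2\cdots j_m}b_{j_2i_2}\cdots b_{j_mi_m}$. $\mathcal{I}=(\delta_{i_1\cdots i_m})$ is the identity tensor of order $m$ and dimension $n$: $\delta_{i_1\cdots i_m}=1$ if $i_1=\cdots=i_m$ and $0$ otherwise. $B$ is an order 2 right inverse of $\mathcal{A}$ if $\mathcal{A}B=\mathcal{I}$. *)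

(* Defs.v *)
From mathcomp Require Import all_boot all_order all_algebra.
From mathcomp Require Import reals.
Set Implicit Arguments.
Unset Strict Implicit.
Unset Printing Implicit Defensive.
Import GRing.Theory.
Local Open Scope ring_scope.

(* Indices run over {0, ..., n-1} and positions over {0, ..., m-1}: the index *)
(* written i_k in the one-based convention is [i (k-1)].                      *)
Definition tensor (R : Type) (m n : nat) :=
  {ffun {ffun 'I_m -> 'I_n} -> R}.

Definition tensor_of_mx (R : Type) (n : nat) (B : 'M[R]_n) : tensor R 2 n :=
  [ffun i : {ffun 'I_2 -> 'I_n} => B (i ord0) (i ord_max)].

(* [rev_ord] is i |-> n - 1 - i, i.e. i |-> n - i + 1 with one-based indices. *)
Definition centrosymmetric (R : Type) (m n : nat) (A : tensor R m n) : Prop :=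
  forall i : {ffun 'I_m -> 'I_n}, A i = A [ffun k => rev_ord (i k)].

(* The sum ranges over j_2, ..., j_m: the guard forces j_1 = i_1.             *)
Definition tensor_mulmx (R : realType) (m n : nat)
    (A : tensor R m n) (B : 'M[R]_n) : tensor R m n :=
  [ffun i : {ffun 'I_m -> 'I_n} =>
    \sum_(j : {ffun 'I_m -> 'I_n}
           | [forall k : 'I_m, (k == 0%N :> nat) ==> (j k == i k)])
      A j * \prod_(k < m | (0 < k)%N) B (j k) (i k)].

Definition id_tensor (R : realType) (m n : nat) : tensor R m n :=
  [ffun i : {ffun 'I_m -> 'I_n} => [forall k, forall l, i k == i l]%:R].

Definition right_inverse2 (R : realType) (m n : nat)
    (A : tensor R m n) (B : 'M[R]_n) : Prop :=
  tensor_mulmx A B = id_tensor R m n.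

(* Main.v *)
(** Contracting [A B = I] with a vector [x] in positions 2, ..., m shows that
    the polynomial map [y |-> A y^(m-1)] sends [B x] to the vector of powers
    [x_a ^ (m-1)].  Hence [B] is invertible, and as [m - 1] is odd and real odd
    powers are injective, this polynomial map determines [B].  Conjugating [B]
    by the reversal of indices gives another right inverse of the
    centrosymmetric [A], so it equals [B]. *)
Require Import Defs.
From mathcomp Require Import all_boot all_order all_algebra.
From mathcomp Require Import reals.
Set Implicit Arguments.
Unset Strict Implicit.
Unset Printing Implicit Defensive.
Import GRing.Theory Num.Theory.
Local Open Scope ring_scope.

(** An odd power preserves the sign, and a positive power is injective on absolute values; sign and
    absolute value together determine [x]. *)
Lemma expr_odd_inj (R : realDomainType) (p : nat) :
  odd p -> injective (fun x : R => x ^+ p).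
Proof.
move=> p_odd x y /= exy.
have p_gt0 := odd_gt0 p_odd.
have sgE (z : R) : Num.sg (z ^+ p) = Num.sg z.
  have [->|z0] := eqVneq z 0; first by rewrite expr0n gtn_eqF.
  by rewrite sgrX sgr_odd // p_odd.
have nE : `|x| = `|y|.
  by apply/eqP; rewrite -(eqrXn2 p_gt0) ?normr_ge0 // -!normrX exy.
by rewrite [x]numEsg [y]numEsg nE -(sgE x) -(sgE y) exy.
Qed.

(** [tensor_apply A x] is the vector usually written [A x^(m-1)]. *)
Definition tensor_apply (R : realType) (m n : nat)
    (A : tensor R m.+1 n) (x : 'rV[R]_n) (a : 'I_n) : R :=
  \sum_(j : {ffun 'I_m.+1 -> 'I_n} | j ord0 == a)
     A j * \prod_(k < m.+1 | (0 < k)%N) x 0 (j k).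

Lemma tensor_mulmxE (R : realType) (m n : nat) (A : tensor R m.+1 n)
    (B : 'M[R]_n) (i : {ffun 'I_m.+1 -> 'I_n}) :
  tensor_mulmx A B i =
  \sum_(j : {ffun 'I_m.+1 -> 'I_n} | j ord0 == i ord0)
     A j * \prod_(k < m.+1 | (0 < k)%N) B (j k) (i k).
Proof.
rewrite ffunE; apply: eq_bigl => j; apply/forallP/eqP => [/(_ ord0)/eqP //|e k].
by apply/implyP => /eqP k0; rewrite (_ : k = ord0) ?e //; apply: val_inj.
Qed.

Lemma tensor_apply_mulmx (R : realType) (m n : nat) (A : tensor R m.+1 n)
    (B : 'M[R]_n) (x : 'rV[R]_n) :
  tensor_apply (tensor_mulmx A B) x =1 tensor_apply A (x *m B^T).
Proof.
move=> a; rewrite /tensor_apply.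
under eq_bigr => i /eqP ia do rewrite tensor_mulmxE ia mulr_suml.
rewrite exchange_big /=; apply: eq_bigr => j /eqP ja.
under eq_bigr => i _ do rewrite -mulrA -big_split /=.
rewrite -mulr_sumr; congr (_ * _).
under [RHS]eq_bigr => k _ do rewrite mxE.
(* Distributing the product gives a sum over maps taking the default value [a] off the positions
   [k > 0]. With default [a], these are exactly the [i] with [i ord0 = a]. *)
rewrite (big_distr_big a) /=; apply: eq_big => [i|i _]; last first.
  by apply: eq_bigr => k _; rewrite mxE mulrC.
apply/eqP/pfamilyP => [ia|[/subsetP supp _]].
  split=> //; apply/subsetP => k; rewrite !inE; apply: contraR.
  rewrite -eqn0Ngt => /eqP k0.
  by rewrite (_ : k = ord0) ?ia //; apply: val_inj.
by apply: contraTeq isT => /supp.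
Qed.

Lemma tensor_apply_id (R : realType) (m n : nat) (x : 'rV[R]_n) (a : 'I_n) :
  tensor_apply (id_tensor R m.+1 n) x a = x 0 a ^+ m.
Proof.
(* Only the constant index [a] contributes, with one factor [x 0 a] for each of the [m] positions
   after the first. *)
rewrite /tensor_apply (bigD1 [ffun=> a]) /=; last by rewrite ffunE.
rewrite [X in _ + X]big1 ?addr0.
  rewrite ffunE; case: forallP => [_|[]]; last first.
    by move=> k; apply/forallP => l; rewrite !ffunE.
  rewrite mul1r big_mkcond big_ord_recl /= mul1r.
  under eq_bigr => k _ do rewrite ffunE.
  by rewrite prodr_const card_ord.
move=> i /andP[/eqP ia ne]; rewrite ffunE; case: forallP => [ic|_]; last first.
  by rewrite mul0r.
case/eqP: ne; apply/ffunP => k; rewrite ffunE -ia.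
by apply/eqP; move/forallP: (ic k).
Qed.

Lemma tensor_apply_right_inverse (R : realType) (m n : nat)
    (A : tensor R m.+1 n) (B : 'M[R]_n) (x : 'rV[R]_n) (a : 'I_n) :
  right_inverse2 A B ->
  tensor_apply A (x *m B^T) a = x 0 a ^+ m.
Proof. by move=> hB; rewrite -tensor_apply_mulmx hB tensor_apply_id. Qed.

(** If [x *m B^T = 0], then [x] and [0] have the same image under [B^T], so
    [x 0 a ^+ m = 0 ^+ m = 0] for every [a]. *)
Lemma right_inverse2_unitmx (R : realType) (m n : nat)
    (A : tensor R m.+1 n) (B : 'M[R]_n) :
  (0 < m)%N -> right_inverse2 A B -> B \in unitmx.
Proof.
move=> m_gt0 hB; rewrite -unitmx_tr -row_free_unit.
apply: inj_row_free => x xB0; apply/rowP => a; rewrite mxE; apply/eqP.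
have := tensor_apply_right_inverse x a hB.
rewrite xB0 -{1}(mul0mx _ B^T) (tensor_apply_right_inverse _ _ hB) mxE.
by move/esym/eqP; rewrite expr0n gtn_eqF // expf_eq0 m_gt0.
Qed.

Lemma right_inverse2_inj (R : realType) (m n : nat)
    (A : tensor R m.+1 n) (B C : 'M[R]_n) :
  odd m -> right_inverse2 A B -> right_inverse2 A C -> B = C.
Proof.
move=> m_odd hB hC; apply: trmx_inj.
have Bu : B^T \in unitmx.
  by rewrite unitmx_tr (right_inverse2_unitmx _ hB) // odd_gt0.
apply/row_matrixP => l; rewrite !rowE.
(* [z] is the vector that [B^T] sends to the image of [x] under [C^T]. Applying [A] to this common
   image gives the [m]-th powers of both [z] and [x]. *)
set x := delta_mx _ _; set z := x *m C^T *m invmx B^T.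
have zB : z *m B^T = x *m C^T by rewrite mulmxKV.
suff zx : z = x by rewrite -zB zx.
apply/rowP => a; apply: (expr_odd_inj m_odd) => /=.
rewrite -(tensor_apply_right_inverse z a hB) zB.
exact: (tensor_apply_right_inverse _ _ hC).
Qed.

Definition rev_index (m n : nat) (i : {ffun 'I_m -> 'I_n}) :
    {ffun 'I_m -> 'I_n} := [ffun k => rev_ord (i k)].

Lemma rev_indexK (m n : nat) : involutive (@rev_index m n).
Proof. by move=> i; apply/ffunP => k; rewrite !ffunE rev_ordK. Qed.

Lemma id_tensor_centrosymmetric (R : realType) (m n : nat) :
  centrosymmetric (id_tensor R m n).
Proof.
move=> i; rewrite !ffunE; congr (nat_of_bool _)%:R.
apply: eq_forallb => k; apply: eq_forallb => l.
by rewrite !ffunE (inj_eq rev_ord_inj).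
Qed.

(** Reversing the summation index [j] moves the reversal from [B] onto [A], which absorbs it by
    centrosymmetry. *)
Lemma tensor_mulmx_rev (R : realType) (m n : nat) (A : tensor R m.+1 n)
    (B : 'M[R]_n) (i : {ffun 'I_m.+1 -> 'I_n}) :
  centrosymmetric A ->
  tensor_mulmx A (\matrix_(k, l) B (rev_ord k) (rev_ord l)) i =
  tensor_mulmx A B (rev_index i).
Proof.
move=> hA; rewrite !tensor_mulmxE.
rewrite [RHS](reindex_inj (inv_inj (@rev_indexK m.+1 n))) /=.
apply: eq_big => [j|j _]; first by rewrite !ffunE (inj_eq rev_ord_inj).
by rewrite hA; congr (_ * _); apply: eq_bigr => k _; rewrite !ffunE mxE.
Qed.

Lemma right_inverse2_rev (R : realType) (m n : nat) (A : tensor R m.+1 n)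
    (B : 'M[R]_n) :
  centrosymmetric A -> right_inverse2 A B ->
  right_inverse2 A (\matrix_(k, l) B (rev_ord k) (rev_ord l)).
Proof.
move=> hA hB; apply/ffunP => i.
by rewrite tensor_mulmx_rev // hB [RHS]id_tensor_centrosymmetric.
Qed.

Theorem theorem3p10 (R : realType) (m n : nat)
  (hm : (2 <= m)%N) (hm_even : ~~ odd m) (hn : (1 <= n)%N)
  (A : tensor R m n) (hA : centrosymmetric A) :
  (exists B : 'M[R]_n, right_inverse2 A B) ->
  exists B : 'M[R]_n,
    unique (right_inverse2 A) B /\ centrosymmetric (tensor_of_mx B).
Proof.
(* From here [m] is the order minus one, hence odd. *)
case: m hm hm_even A hA => // m _; rewrite /= negbK => m_odd A hA [B hB].
exists B; split.
  by split=> // C hC; apply: right_inverse2_inj hB hC.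
move=> i; rewrite !ffunE.
rewrite [in LHS](right_inverse2_inj m_odd hB (right_inverse2_rev hA hB)).
by rewrite mxE.
Qed.
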